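(* Let $p$ be a prime. For every non-cyclic finite $p$-group $P$ and every prime $q\ne p$ there exists an elementary abelian $q$-group $N$ such that $P$ acts on $N$ (by automorphisms) and the semidirect product $G:=N\rtimes P$ has the following properties: (i) $P$ is redundant in $G$. (ii) $|G_p|\le\frac{1}{q^{p-1}}|G|$. (iii) $G_p$ is covered by $\frac{1}{q^{p-1}}\nu_p(G)$ Sylow $p$-subgroups of $G$, i.e. there is a set of $\frac{1}{q^{p-1}}\nu_p(G)$ Sylow $p$-subgroups of $G$ whose union is $G_p$.
   Context: All groups are finite. For a finite group $G$ and a prime $p$, $G_p$ denotes the set of $p$-elements of $G$ (elements whose order is a power of $p$, including the identity), and $\nu_p(G)$ denotes the number of Sylow $p$-subgroups of $G$. A Sylow $p$-subgroup $P$ of $G$ is called redundant (in $G$) if every $p$-element of $G$ lies in a Sylow $p$-subgroup of $G$ different from $P$, i.e. $G_p$ is the union of the Sylow $p$-subgroups of $G$ other than $P$. *)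

(* Defs.v *)
From mathcomp Require Import all_boot all_order all_algebra.
From mathcomp Require Import all_fingroup all_solvable.

Set Implicit Arguments.
Unset Strict Implicit.
Unset Printing Implicit Defensive.

Import GroupScope.

Definition p_elements (p : nat) (gT : finGroupType) (G : {group gT}) :
    {set gT} :=
  [set x in G | p.-elt x].

Definition redundant (p : nat) (gT : finGroupType) (G P : {group gT}) : Prop :=
  P \in 'Syl_p(G) /\
  forall x : gT, x \in p_elements p G ->
    exists Q : {group gT}, [/\ Q \in 'Syl_p(G), Q != P & x \in Q].

Definition nu (p : nat) (gT : finGroupType) (G : {group gT}) : nat :=
  #|'Syl_p(G)|.

(* Main.v *)
Require Import Defs.
From mathcomp Require Import all_boot all_order all_algebra.
From mathcomp Require Import all_fingroup all_solvable.
From mathcomp Require Import mxabelem.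

Set Implicit Arguments.
Unset Strict Implicit.
Unset Printing Implicit Defensive.

Import GroupScope.

(** The module N is built so that every element of P centralizes one of its
    direct summands while P as a whole fixes no nonzero vector.

    Since P is not cyclic, each x in P lies in a maximal subgroup, hence in
    the kernel of a homomorphism chi_x from P onto Z/p
    ([exists_character_killing]).  Let V be the space of functions from Z/p
    to F_q with zero sum, of dimension p - 1, and let N be a direct sum of
    copies of V indexed by P, where P acts on the copy of index x by
    translations through chi_x.  A translation-invariant function is constant,
    and a constant with zero sum vanishes because q <> p; so C_N(P) = 1,
    whereas C_N(x) contains the whole copy of index x.  All copies being the
    same space V, the elements of N whose components add up to zero form a
    subgroup X which complements every copy: hence N = C_N(x) X for each x in
    P, and |N| = |X| q^(p-1) ([row_sum0_split], [card_row_sum0]).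

    In G = N : P the Sylow p-subgroups are the conjugates P^n with n in N, and
    they are pairwise distinct as N_N(P) = C_N(P) = 1 ([Syl_compl],
    [conj_compl_inj]); so there are |N| of them.  If x is in P and c in C_N(x),
    then x^(c m) = x^m lies in P^m; so N = C_N(x) X for all x in P means that
    the P^m with m in X already cover all the p-elements
    ([cover_p_elements]), which gives (iii), and (ii) by counting elements.
    Likewise, x lies in P^c with c in C_N(x), which differs from P as soon as
    c <> 1; this gives (i) ([redundant_compl]). *)

(** * Sylow subgroups of a coprime semidirect product *)

Lemma compl_Sylow (p : nat) (gT : finGroupType) (G N P : {group gT}) :
  N ><| P = G -> p.-group P -> p^'.-group N -> p.-Sylow(G) P.
Proof.
move=> defG pP p'N; have [nsNG sPG _ _ _] := sdprod_context defG.
rewrite /pHall sPG pP -divgS // -(sdprod_card defG) mulnK //.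
Qed.

(** By Sylow's theorem, as P absorbs the P-component of a conjugating
    element. *)
Lemma Syl_compl (p : nat) (gT : finGroupType) (G N P : {group gT}) :
    N ><| P = G -> p.-group P -> p^'.-group N ->
  'Syl_p(G) = [set (P :^ n)%G | n in N].
Proof.
move=> defG pP p'N; have sylP := compl_Sylow defG pP p'N.
have [nsNG _ _ nNP _] := sdprod_context defG.
apply/setP=> Q; rewrite inE; apply/idP/imsetP=> [sylQ | [n Nn ->]]; last first.
  by rewrite pHallJ // (subsetP (normal_sub nsNG)).
have [g Gg defQ] := Sylow_trans sylP sylQ.
move: Gg defQ; rewrite -(sdprodW defG) -(normC nNP) => /mulsgP[x n Px Nn ->] defQ.
by exists n => //; apply: val_inj; rewrite /= defQ conjsgM conjGid.
Qed.

(** If P :^ m = P :^ n then m / n normalizes P; by coprimality the normalizer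
    of P in N centralizes P. *)
Lemma conj_compl_inj (p : nat) (gT : finGroupType) (G N P : {group gT}) :
    N ><| P = G -> p.-group P -> p^'.-group N -> 'C_N(P) = 1 ->
  {in N &, injective (fun n => (P :^ n)%G)}.
Proof.
move=> defG pP p'N regP m n Nm Nn /(congr1 val)/= eqPmn.
have [_ _ _ nNP _] := sdprod_context defG.
have normP1 : 'N_N(P) = 1.
  by rewrite coprime_norm_cent // coprime_sym (pnat_coprime pP).
apply/eqP; rewrite eq_mulgV1 -in_set1 -set1gE -normP1.
by rewrite inE groupM ?groupV //=; apply/normP; rewrite conjsgM eqPmn conjsgK.
Qed.

Lemma mem_conj_cent (gT : finGroupType) (P : {group gT}) (x c n : gT) :
  x \in P -> c \in 'C[x] -> x ^ (c * n) \in P :^ n.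
Proof.
move=> Px /cent1P cxc; rewrite conjgM memJ_conjg.
by rewrite conjgE -cxc mulKg.
Qed.

(** A p-element has the form x ^ n with x in P and n in N.  Only the coset of
    n modulo the centralizer of x matters, so that n can be moved into X. *)
Lemma cover_p_elements (p : nat) (gT : finGroupType) (G N P : {group gT})
    (X : {set gT}) :
    N ><| P = G -> p.-group P -> p^'.-group N -> X \subset N ->
    {in P, forall x, N \subset 'C_N[x] * X} ->
  \bigcup_(Q in [set (P :^ n)%G | n in X]) Q = p_elements p G.
Proof.
move=> defG pP p'N sXN covX; have sylP := compl_Sylow defG pP p'N.
have [nsNG sPG _ _ _] := sdprod_context defG.
apply/setP=> y; apply/bigcupP/setIdP=> [[_ /imsetP[n Xn ->] Pny] | [Gy py]].
  have Gn: n \in G by rewrite (subsetP (normal_sub nsNG)) ?(subsetP sXN).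
  split; first by apply: subsetP Pny; rewrite /= conj_subG.
  by apply: mem_p_elt Pny; rewrite pgroupJ.
have sCyG: <[y]> \subset G by rewrite cycle_subG.
have [Q sylQ] := Sylow_superset sCyG py; rewrite cycle_subG.
have: Q \in 'Syl_p(G) by rewrite inE.
rewrite (Syl_compl defG pP p'N) => /imsetP[n Nn ->] /imsetP[x Px ->].
have /mulsgP[c m /setIP[_ cxc] Xm ->] := subsetP (covX x Px) n Nn.
by exists (P :^ m)%G; [exact: imset_f | exact: mem_conj_cent].
Qed.

(** An element of P also lies in P :^ c for every c centralizing it, and
    P :^ c differs from P for c != 1 in N. *)
Lemma redundant_compl (p : nat) (gT : finGroupType) (G N P : {group gT}) :
    N ><| P = G -> p.-group P -> p^'.-group N -> 'C_N(P) = 1 ->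
    {in P, forall x, 'C_N[x] :!=: 1} ->
  redundant p G P.
Proof.
move=> defG pP p'N regP nregx; have sylP := compl_Sylow defG pP p'N.
split=> [|y /setIdP[Gy py]]; first by rewrite inE.
have [Py | notPy] := boolP (y \in P).
  have /trivgPn[c /setIP[Nc cyc] ntc] := nregx y Py.
  have sylE := Syl_compl defG pP p'N.
  exists (P :^ c)%G; split; first by rewrite sylE imset_f.
    apply: contra ntc => /eqP eqPc; apply/eqP.
    apply: (conj_compl_inj defG pP p'N regP) => //.
    by rewrite eqPc; apply: val_inj; rewrite /= conjsg1.
  by rewrite /= -[y]conjg1 -(mulVg c) mem_conj_cent ?groupV.
have sCyG: <[y]> \subset G by rewrite cycle_subG.
have [Q sylQ] := Sylow_superset sCyG py; rewrite cycle_subG => Qy.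
by exists Q; split; rewrite ?inE //; apply: contraNneq notPy => <-.
Qed.

(** * Characters of a non-cyclic p-group *)

(** As <[x]> is not P, it lies in a maximal subgroup M, which is normal of
    index p; chi is the projection onto P / M. *)
Lemma exists_character_killing (p : nat) (gT : finGroupType) (P : {group gT})
    (x : gT) :
    prime p -> p.-group P -> ~~ cyclic P -> x \in P ->
  exists chi : gT -> 'Z_p,
    [/\ {in P &, {morph chi : y z / y * z >-> (y + z)%R}}, chi x = 0%R
      & exists2 y, y \in P & chi y = 1%R].
Proof.
move=> p_pr pP ncP Px; have p_gt1 := prime_gt1 p_pr.
have sxP : <[x]> \subset P by rewrite cycle_subG.
have [eqxP | [M maxM]] := maximal_exists sxP.
  by case/negP: ncP; apply/cyclicP; exists x.
rewrite cycle_subG => Mx.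
have nsMP := p_maximal_normal pP maxM; have nMP := normal_norm nsMP.
have oPM: #|P / M| = p by rewrite card_quotient ?(p_maximal_index pP).
have cPM: cyclic (P / M) by rewrite prime_cyclic ?oPM.
have /isogP[f injf imf] : P / M \isog [set: 'Z_p].
  rewrite isog_cyclic_card //= oPM cardsT card_ord Zp_cast // eqxx andbT.
  by rewrite prime_cyclic // cardsT card_ord Zp_cast.
exists (fun y => f (coset M y)); split=> [y z Py Pz /= | | ].
- by rewrite morphM ?(subsetP nMP) // morphM ?mem_quotient.
- by rewrite coset_id // morph1.
have: 1%R \in f @* (P / M) by rewrite imf inE.
case/morphimP=> _ _ /morphimP[y nMy Py ->] ->.
by exists y.
Qed.

(** * Matrices with vanishing row and column sums *)

Section Module.
Import GRing.Theory.
Local Open Scope ring_scope.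

(** Each row is a function with zero sum, so that this is a direct sum of m
    copies of the space of such functions. *)
Definition row_sum0 (F : finFieldType) (m n : nat) : {set 'M[F]_(m, n)} :=
  [set A | A *m (const_mx 1 : 'cV_n) == 0].

(** The column sums vanish when the rows, as vectors, add up to zero. *)
Definition row_col_sum0 (F : finFieldType) (m n : nat) : {set 'M[F]_(m, n)} :=
  [set A in row_sum0 F m n | (const_mx 1 : 'rV_m) *m A == 0].

Lemma row_sum0P (F : finFieldType) (m n : nat) (A : 'M[F]_(m, n)) :
  reflect (forall i, \sum_j A i j = 0) (A \in row_sum0 F m n).
Proof.
have sumE i j : (A *m (const_mx 1 : 'cV_n)) i j = \sum_k A i k.
  by rewrite mxE; apply: eq_bigr => k _; rewrite mxE mulr1.
rewrite inE; apply: (iffP eqP) => [A0 i | A0]; first by rewrite -(sumE i 0) A0 mxE.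
by apply/matrixP=> i j; rewrite sumE A0 mxE.
Qed.

Fact row_sum0_group_set (F : finFieldType) (m n : nat) :
  group_set (row_sum0 F m n).
Proof.
apply/group_setP; split=> [|A B]; rewrite !inE ?mul0mx // => /eqP A0 /eqP B0.
by rewrite mulmxDl A0 B0 addr0.
Qed.

Canonical row_sum0_group (F : finFieldType) (m n : nat) :=
  Group (row_sum0_group_set F m n).

Lemma sum_rows_delta (F : finFieldType) (m : nat) (i : 'I_m) :
  (const_mx 1 : 'rV[F]_m) *m (delta_mx i 0 : 'cV_m) = 1%:M.
Proof.
apply/matrixP=> j k; rewrite !mxE (bigD1 i) //= !mxE !eqxx !ord1 mulr1.
by rewrite big1 ?addr0 // => l /negPf nli; rewrite !mxE nli mulr0.
Qed.

(** [delta_mx i 0 *m v] is the matrix with row [i] equal to [v] and zero rows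
    elsewhere.  Subtracting from [A] the one for which [v] is the sum of the
    rows of [A] leaves a matrix with vanishing column sums; hence
    [row_col_sum0] complements the copy carried by any single row. *)
Lemma row_sum0_split (F : finFieldType) (m n : nat) (i : 'I_m) :
  row_sum0 F m n =
    [set delta_mx i 0 *m v + A | v in rowg (kermx (const_mx 1 : 'cV[F]_n)),
                                 A in row_col_sum0 F m n].
Proof.
apply/setP=> A; apply/idP/imset2P => [NA | [v B]]; last first.
  rewrite mem_rowg => /sub_kermxP v0; rewrite !inE => /andP[B0 _] ->.
  by rewrite mulmxDl -mulmxA v0 mulmx0 add0r.
have A0 : A *m (const_mx 1 : 'cV_n) = 0 by move: NA; rewrite inE => /eqP.
pose v := (const_mx 1 : 'rV_m) *m A.
have v0 : v *m (const_mx 1 : 'cV_n) = 0 by rewrite -mulmxA A0 mulmx0.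
exists v (A - delta_mx i 0 *m v).
- by rewrite mem_rowg; apply/sub_kermxP.
- rewrite !inE mulmxBl A0 -mulmxA v0 mulmx0 subr0 eqxx /= mulmxBr mulmxA.
  by rewrite sum_rows_delta mul1mx subrr.
- by rewrite addrC subrK.
Qed.

Lemma card_ker_sum (F : finFieldType) (n : nat) : (0 < n)%N ->
  #|rowg (kermx (const_mx 1 : 'cV[F]_n))| = (#|F| ^ n.-1)%N.
Proof.
move=> n_gt0; rewrite card_rowg mxrank_ker -mxrank_tr rank_rV.
case: eqP => [/matrixP|]; last by rewrite subn1.
by move/(_ 0 (Ordinal n_gt0))/eqP; rewrite !mxE oner_eq0.
Qed.

Lemma card_row_sum0 (F : finFieldType) (m n : nat) : (0 < m)%N -> (0 < n)%N ->
  #|row_sum0 F m n| = (#|row_col_sum0 F m n| * #|F| ^ n.-1)%N.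
Proof.
move=> m_gt0 n_gt0; pose i := Ordinal m_gt0.
rewrite (row_sum0_split F n i) -(card_ker_sum F n_gt0) mulnC.
rewrite curry_imset2X card_in_imset ?cardsX // => -[v A] [w B] /=.
rewrite !inE /= => /andP[_ /andP[_ /eqP A0]] /andP[_ /andP[_ /eqP B0]] eqAB.
have eqvw : v = w.
  have /(congr1 (mulmx (const_mx 1 : 'rV_m))) := eqAB.
  by rewrite !mulmxDr A0 B0 !addr0 !mulmxA sum_rows_delta !mul1mx.
by move: eqAB; rewrite eqvw => /addrI->.
Qed.

(** * Translating rows by characters *)

Section Shift.
Variables (F : finFieldType) (p m : nat) (pT : finGroupType) (P : {group pT}).
Variable chi : 'I_m -> pT -> 'Z_p.
Hypothesis chiM : forall i, {in P &, {morph chi i : y z / (y * z)%g >-> y + z}}.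

Definition shift (A : 'M[F]_(m, (Zp_trunc p).+2)) (x : pT) :=
  \matrix_(i, c) A i (c - chi i x).

Fact shift_is_action : is_action P shift.
Proof.
split=> [x A B /matrixP eqAB | A x y Px Py]; apply/matrixP=> i c.
  by have:= eqAB i (c + chi i x); rewrite !mxE addrK.
by rewrite !mxE chiM // opprD addrA addrAC.
Qed.
Canonical shift_action := Action shift_is_action.

Fact shift_is_groupAction : is_groupAction setT shift_action.
Proof.
move=> x Px; rewrite inE; apply/andP; split; first by apply/subsetP=> A; rewrite inE.
by apply/morphicP=> A B _ _; rewrite !actpermE /=; apply/matrixP=> i c; rewrite !mxE.
Qed.
Canonical shift_groupAction := GroupAction shift_is_groupAction.

Lemma acts_shift : {acts P, on group row_sum0 F m (Zp_trunc p).+2 | shift_groupAction}.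
Proof.
split; last exact: subsetT.
apply/subsetP=> x Px; rewrite !inE Px; apply/subsetP=> A /row_sum0P A0.
rewrite inE; apply/row_sum0P => i; rewrite -[RHS](A0 i).
rewrite (reindex_inj (addIr (chi i x))) /=.
by apply: eq_bigr => c _; rewrite mxE addrK.
Qed.

Hypothesis chi_onto : forall i, exists2 y, y \in P & chi i y = 1.
Hypothesis pF : p%:R != 0 :> F.
Hypothesis p_gt1 : (1 < p)%N.

(** In each row, invariance under an element [y] with [chi i y = 1] makes the
    entries all equal, to [a] say, and the row sum is then [p * a]. *)
Lemma gacent_shift : 'C_(|<[acts_shift]>)(P) = 1%g.
Proof.
rewrite gacent_actby setIid; apply/trivgP/subsetP=> A.
case/setIP=> /row_sum0P A0 /setIP[_]; rewrite setIid => /afixP cA.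
rewrite inE; apply/eqP/matrixP=> i c; rewrite mxE.
have [y Py chi1] := chi_onto i.
have A1 d : A i (d + 1) = A i d.
  by have /matrixP/(_ i (d + 1)) := cA y Py; rewrite mxE chi1 addrK.
have const d : A i d = A i 0.
  rewrite -[d]natr_Zp; elim: (d : nat) => // k IH.
  by rewrite -natr1 A1.
have := A0 i; rewrite (eq_bigr (fun=> A i 0)) => [|d _]; last exact: const.
rewrite sumr_const card_ord const -mulr_natr [X in X%:R]Zp_cast // => /eqP.
by rewrite mulf_eq0 (negPf pF) orbF => /eqP.
Qed.

Lemma gacent1_shift (x : pT) (A : 'M[F]_(m, (Zp_trunc p).+2)) : x \in P ->
  (A \in 'C_(|<[acts_shift]>)[x]) =
    (A \in row_sum0 F m (Zp_trunc p).+2) && (shift A x == A).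
Proof.
move=> Px; rewrite gacent_actby in_setI; congr (_ && _).
by rewrite (setIidPr _) ?sub1set // gacent1E // in_setI in_setT; apply/afix1P/eqP.
Qed.

Lemma delta_fixed (x : pT) (i : 'I_m) (v : 'rV[F]_(Zp_trunc p).+2) :
  chi i x = 0 -> shift (delta_mx i 0 *m v) x = delta_mx i 0 *m v.
Proof.
move=> chix; apply/matrixP=> j c; rewrite !mxE.
apply: eq_bigr => k _; rewrite !mxE.
by case: eqP => [-> | _]; rewrite ?chix ?subr0 ?mul0r.
Qed.
End Shift.

(** The rows are indexed by the elements of P, the row of [x] being translated
    through a character that kills [x]; then [x] fixes all the matrices
    supported on that row. *)
Lemma exists_module_with_common_supplement (p q : nat)
    (pT : finGroupType) (P : {group pT}) :
    prime p -> prime q -> q != p -> p.-group P -> ~~ cyclic P ->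
  exists (nT : finGroupType) (N : {group nT}) (to : groupAction P N) (X : {set nT}),
    [/\ q.-abelem N, 'C_(|to)(P) = 1%g,
        {in P, forall x, 'C_(|to)[x] :!=: 1%g},
        X \subset N /\ {in P, forall x, N \subset ('C_(|to)[x] * X)%g}
      & #|N| = (#|X| * q ^ p.-1)%N].
Proof.
move=> p_pr q_pr neq_qp pP ncP; have p_gt1 := prime_gt1 p_pr.
have pE : (Zp_trunc p).+2 = p by rewrite Zp_cast.
have m_gt0 : (0 < #|P|)%N by rewrite cardG_gt0.
have [chi chiP] := fin_all_exists (fun i : 'I_#|P| =>
  exists_character_killing p_pr pP ncP (enum_valP i)).
have chiM i : {in P &, {morph chi i : y z / (y * z)%g >-> y + z}}.
  by have [] := chiP i.
have chi_onto i : exists2 y, y \in P & chi i y = 1 by have [] := chiP i.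
have pF : p%:R != 0 :> 'F_q.
  by rewrite -(dvdn_pcharf (pchar_Fp q_pr)) dvdn_prime2.
pose n := (Zp_trunc p).+2.
pose N := row_sum0_group 'F_q #|P| n.
pose to := <[acts_shift 'F_q chiM]>%gact.
have deltaC x (Px : x \in P) v : v \in rowg (kermx (const_mx 1 : 'cV['F_q]_n)) ->
    delta_mx (enum_rank_in Px x) 0 *m v \in 'C_(|to)[x].
  rewrite mem_rowg => /sub_kermxP v0.
  have chix0 : chi (enum_rank_in Px x) x = 0.
    by have [_ + _] := chiP (enum_rank_in Px x); rewrite enum_rankK_in.
  by rewrite gacent1_shift // inE -mulmxA v0 mulmx0 delta_fixed ?eqxx.
exists _, N, to, (row_col_sum0 'F_q #|P| n); split.
- by rewrite (abelemS (subsetT _)) ?mx_Fp_abelem.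
- exact: gacent_shift.
- move=> x Px; apply/trivgPn.
  have : rowg (kermx (const_mx 1 : 'cV['F_q]_n)) :!=: 1%g.
    rewrite -cardG_gt1 card_ker_sum // card_Fp // /n pE -(expn0 q).
    by rewrite ltn_exp2l ?prime_gt1 // -ltnS prednK ?prime_gt0.
  case/trivgPn=> v Kv nzv; exists (delta_mx (enum_rank_in Px x) 0 *m v).
    exact: deltaC.
  apply: contraNneq nzv => /(congr1 (mulmx (const_mx 1 : 'rV_#|P|))).
  by rewrite mulmxA sum_rows_delta mul1mx mulmx0 => ->.
- split=> [|x Px]; first by apply/subsetP=> A /setIdP[].
  have /setP splitN := row_sum0_split 'F_q n (enum_rank_in Px x).
  apply/subsetP=> A; rewrite /= splitN.
  case/imset2P=> v B Kv XB ->; exact: mem_mulg (deltaC x Px v Kv) XB.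
- by rewrite card_row_sum0 // card_Fp // /n pE.
Qed.
End Module.

(** * The semidirect product *)

Theorem theorem1 (p : nat) (p_pr : prime p)
    (pT : finGroupType) (P : {group pT}) (pP : p.-group P) (ncP : ~~ cyclic P)
    (q : nat) (q_pr : prime q) (neq_qp : q != p) :
  exists (nT : finGroupType) (N : {group nT}) (to : groupAction P N),
    q.-abelem N /\
    let G := [set: sdprod_by to]%G in
    [/\ redundant p G (sdpair2 to @* P)%G,
        (#|p_elements p G|%:R <= 1 / (q%:R ^+ (p - 1)) * #|G|%:R :> rat)%R
      & exists S : {set {group sdprod_by to}},
          [/\ S \subset 'Syl_p(G),
              (#|S|%:R = 1 / (q%:R ^+ (p - 1)) * (nu p G)%:R :> rat)%R
            & \bigcup_(Q in S) Q = p_elements p G]].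
Proof.
have [nT [N [to [X [abelN regP nregx [sXN covX] cardX]]]]] :=
  exists_module_with_common_supplement p_pr q_pr neq_qp pP ncP.
exists nT, N, to; split=> // G.
set N1 := (sdpair1 to @* N)%G; set P1 := (sdpair2 to @* P)%G.
have defG : N1 ><| P1 = G by apply: sdprod_sdpair.
have pP1 : p.-group P1 by rewrite morphim_pgroup.
have p'N1 : p^'.-group N1.
  rewrite morphim_pgroup //; apply: sub_in_pnat (abelem_pgroup abelN) => r _ /eqnP->.
  by rewrite !inE.
have imC (A : {set pT}) : sdpair1 to @* 'C_(|to)(A) = 'C_N1(sdpair2 to @* A).
  by rewrite gacentEsd -morphpreIdom morphim_setIpre.
have imC1 x : x \in P -> sdpair1 to @* 'C_(|to)[x] = 'C_N1[sdpair2 to x].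
  by move=> Px; rewrite imC morphim_set1 // cent_set1.
have regP1 : 'C_N1(P1) = 1 by rewrite -imC regP morphim1.
pose X1 := sdpair1 to @* X.
have sXN1 : X1 \subset N1 by apply: morphimS.
have cardX1 : #|X1| = #|X| by rewrite card_injm ?injm_sdpair1.
have cardN1 : #|N1| = #|N| by rewrite card_injm ?injm_sdpair1.
have nregx1 : {in P1, forall x, 'C_N1[x] :!=: 1}.
  move=> _ /morphimP[x _ Px ->]; rewrite -imC1 //.
  by rewrite morphim_injm_eq1 ?nregx ?injm_sdpair1 ?subsetIl.
have covX1 : {in P1, forall x, N1 \subset 'C_N1[x] * X1}.
  move=> _ /morphimP[x _ Px ->]; rewrite -imC1 //.
  rewrite -morphimMl ?subsetIl //; exact: morphimS (covX x Px).
pose S := [set (P1 :^ n)%G | n in X1].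
have conj_inj := conj_compl_inj defG pP1 p'N1 regP1.
have SylE := Syl_compl defG pP1 p'N1.
have covG : \bigcup_(Q in S) Q = p_elements p G.
  exact: cover_p_elements defG pP1 p'N1 sXN1 covX1.
have cardS : #|S| = #|X|.
  by rewrite card_in_imset // => a b /(subsetP sXN1) Na /(subsetP sXN1) Nb; apply: conj_inj.
(* Both numerical claims reduce to |N| = |X| q^(p-1) through this. *)
have scaleE (a b : nat) : b = (a * q ^ p.-1)%N -> (a%:R = 1 / q%:R ^+ (p - 1) * b%:R :> rat)%R.
  move=> ->; rewrite GRing.natrM GRing.natrX subn1 GRing.mul1r.
  rewrite GRing.mulrC GRing.mulfK // GRing.expf_neq0 // Num.Theory.pnatr_eq0.
  by rewrite -lt0n prime_gt0.
split; first exact: redundant_compl defG pP1 p'N1 regP1 nregx1.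
  have -> : (1 / q%:R ^+ (p - 1) * #|G|%:R = (#|X| * #|P1|)%:R :> rat)%R.
    by apply/esym/scaleE; rewrite -(sdprod_card defG) cardN1 cardX mulnAC.
  (* The |X| Sylow subgroups of S, of order |P| each, cover the p-elements. *)
  rewrite Num.Theory.ler_nat -covG.
  have -> : (#|X| * #|P1| = \sum_(Q in S) #|Q|)%N.
    rewrite -cardS -sum_nat_const; apply: eq_bigr => _ /imsetP[n _ ->].
    by rewrite cardJg.
  elim/big_rec2: _ => [|Q A k _ leAk]; first by rewrite cards0.
  by rewrite (leq_trans (leq_card_setU _ _)) // leq_add2l.
exists S; split=> //; first by rewrite SylE imsetS.
by apply: scaleE; rewrite cardS /nu SylE card_in_imset // cardN1.
Qed.
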